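(* Let $\mathbf{k}$ be a commutative unitary ring, let $\lambda\in\mathbf{k}$, and let $(A,\ast)$ be a $\mathbf{k}$-algebra. Let $\mathbf{IO}^{\mathrm{alg}}(A,\ast)=\mathbf{IO}^{\mathrm{alg}}_\lambda(A,\ast)$ be the set of all invertible (i.e. bijective) $\mathcal{O}$-operators $\alpha:R\to A$ on the algebra $R$ of weight $\lambda$, where $R=(R,\circ,\ell,r)$ is an $A$-bimodule $\mathbf{k}$-algebra. Let $\mathbf{DT}(A,\ast)$ be the set of dendriform trialgebra structures $(A,\prec,\succ,\cdot)$ on the $\mathbf{k}$-module $A$ such that $\ast=\prec+\succ+\cdot$. Let $$\Psi^{\mathrm{alg}}_A:\mathbf{IO}^{\mathrm{alg}}(A,\ast)\to\mathbf{DT}(A,\ast),\qquad \alpha\mapsto(A,\prec_{\alpha,A},\succ_{\alpha,A},\cdot_{\alpha,A}),$$ where, for $x,y\in A$, $x\prec_{\alpha,A}y=\alpha(\alpha^{-1}(x)\,r(y))$, $x\succ_{\alpha,A}y=\alpha(\ell(x)\alpha^{-1}(y))$, $x\cdot_{\alpha,A}y=\alpha(\lambda\,\alpha^{-1}(x)\circ\alpha^{-1}(y))$. Then $\Psi^{\mathrm{alg}}_A$ induces bijections $$\Psi^{\mathrm{alg}}_{A,\cong}:\mathbf{IO}^{\mathrm{alg}}(A,\ast)/{\cong}\;\longrightarrow\;\mathbf{DT}(A,\ast),\qquad \Psi^{\mathrm{alg}}_{A,\sim}:\mathbf{IO}^{\mathrm{alg}}(A,\ast)/{\sim}\;\longrightarrow\;\mathbf{DT}(A,\ast)/{\cong}.$$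 In particular, $\Psi^{\mathrm{alg}}_A$ is surjective. Similarly, let $\mathbf{IO}^{\mathrm{mod}}(A,\ast)$ be the set of all invertible $\mathcal{O}$-operators $\alpha:V\to A$ on the module $V$, where $V=(V,\ell,r)$ is an $A$-bimodule, let $\mathbf{DD}(A,\ast)$ be the set of dendriform dialgebra structures $(A,\prec,\succ)$ on the $\mathbf{k}$-module $A$ such that $\ast=\prec+\succ$, and let $\Psi^{\mathrm{mod}}_A:\mathbf{IO}^{\mathrm{mod}}(A,\ast)\to\mathbf{DD}(A,\ast)$, $\alpha\mapsto(A,\prec_{\alpha,A},\succ_{\alpha,A})$, with $\prec_{\alpha,A},\succ_{\alpha,A}$ given by the same formulas. Then $\Psi^{\mathrm{mod}}_A$ induces bijections $$\mathbf{IO}^{\mathrm{mod}}(A,\ast)/{\cong}\;\longrightarrow\;\mathbf{DD}(A,\ast),\qquad \mathbf{IO}^{\mathrm{mod}}(A,\ast)/{\sim}\;\longrightarrow\;\mathbf{DD}(A,\ast)/{\cong},$$ and in particular $\Psi^{\mathrm{mod}}_A$ is surjective.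
   Context: A $\mathbf{k}$-algebra means an associative, not necessarily unitary, $\mathbf{k}$-algebra. Bimodules. For a $\mathbf{k}$-algebra $(A,\ast)$, an $A$-bimodule $(V,\ell,r)$ is a $\mathbf{k}$-module $V$ with $\mathbf{k}$-linear maps $\ell,r:A\to\mathrm{End}_{\mathbf{k}}(V)$, where $r(x)$ is written on the right of its argument ($v\,r(x)$ denotes $r(x)$ applied to $v$), such that for all $x,y\in A$, $v\in V$: $\ell(x\ast y)v=\ell(x)(\ell(y)v)$, $v\,r(x\ast y)=(v\,r(x))\,r(y)$, $(\ell(x)v)\,r(y)=\ell(x)(v\,r(y))$. An $A$-bimodule homomorphism is a $\mathbf{k}$-linear map commuting with the left and right actions of $A$. An $A$-bimodule $\mathbf{k}$-algebra $(R,\circ,\ell,r)$ is a $\mathbf{k}$-algebra $(R,\circ)$ together with an $A$-bimodule structure $(R,\ell,r)$ such that for all $x\in A$, $v,w\in R$: $\ell(x)(v\circ w)=(\ell(x)v)\circ w$, $(v\circ w)\,r(x)=v\circ(w\,r(x))$, $(v\,r(x))\circ w=v\circ(\ell(x)w)$. A homomorphism of $A$-bimodule $\mathbf{k}$-algebras is a $\mathbf{k}$-linear map that is both an $A$-bimodule homomorphism and a $\mathbf{k}$-algebra homomorphism; an isomorphism is a bijective homomorphism. $\mathcal{O}$-operators. Given an $A$-bimodule $(V,\ell,r)$, a $\mathbf{k}$-linear map $\alpha:V\to A$ is an $\mathcal{O}$-operator on the module $V$ if $\alpha(u)\ast\alpha(v)=\alpha(\ell(\alpha(u))v)+\alpha(u\,r(\alpha(v)))$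 for all $u,v\in V$. Given an $A$-bimodule $\mathbf{k}$-algebra $(R,\circ,\ell,r)$ and $\lambda\in\mathbf{k}$, a $\mathbf{k}$-linear map $\alpha:R\to A$ is an $\mathcal{O}$-operator on the algebra $R$ of weight $\lambda$ if $\alpha(u)\ast\alpha(v)=\alpha(\ell(\alpha(u))v)+\alpha(u\,r(\alpha(v)))+\lambda\,\alpha(u\circ v)$ for all $u,v\in R$. A dendriform dialgebra is a $\mathbf{k}$-module $D$ with bilinear operations $\prec,\succ$ such that, with $x\star y=x\prec y+x\succ y$, for all $x,y,z\in D$: $(x\prec y)\prec z=x\prec(y\star z)$, $(x\succ y)\prec z=x\succ(y\prec z)$, $x\succ(y\succ z)=(x\star y)\succ z$. A dendriform trialgebra is a $\mathbf{k}$-module $T$ with bilinear operations $\prec,\succ,\cdot$ such that, with $x\star y=x\prec y+x\succ y+x\cdot y$, for all $x,y,z\in T$: $(x\prec y)\prec z=x\prec(y\star z)$, $(x\succ y)\prec z=x\succ(y\prec z)$, $(x\star y)\succ z=x\succ(y\succ z)$, $(x\succ y)\cdot z=x\succ(y\cdot z)$, $(x\prec y)\cdot z=x\cdot(y\succ z)$, $(x\cdot y)\prec z=x\cdot(y\prec z)$, $(x\cdot y)\cdot z=x\cdot(y\cdot z)$. It is known that for invertible $\alpha$ the operations $\prec_{\alpha,A},\succ_{\alpha,A},\cdot_{\alpha,A}$ (resp. $\prec_{\alpha,A},\succ_{\alpha,A}$) in the claim give elements of $\mathbf{DT}(A,\ast)$ (resp. $\mathbf{DD}(A,\ast)$), so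 the maps $\Psi^{\mathrm{alg}}_A$, $\Psi^{\mathrm{mod}}_A$ are well defined. Equivalence relations. Let $\alpha_i:(R_i,\circ_i,\ell_i,r_i)\to A$, $i=1,2$, be invertible $\mathcal{O}$-operators. They are isomorphic, $\alpha_1\cong\alpha_2$, if there is an isomorphism $g:(R_1,\circ_1,\ell_1,r_1)\to(R_2,\circ_2,\ell_2,r_2)$ of $A$-bimodule $\mathbf{k}$-algebras with $\alpha_1=\alpha_2 g$. They are equivalent, $\alpha_1\sim\alpha_2$, if there exist a $\mathbf{k}$-algebra automorphism $f:A\to A$ and an isomorphism $g:(R_1,\circ_1,\ell_1f^{-1},r_1f^{-1})\to(R_2,\circ_2,\ell_2,r_2)$ of $A$-bimodule $\mathbf{k}$-algebras such that $f\alpha_1=\alpha_2 g$ (here $\ell_1f^{-1}$, $r_1f^{-1}$ denote the compositions $A\to A\to\mathrm{End}_{\mathbf{k}}(R_1)$). For invertible $\mathcal{O}$-operators on modules, $\cong$ and $\sim$ are defined in the same way with $A$-bimodules and $A$-bimodule isomorphisms in place of $A$-bimodule $\mathbf{k}$-algebras and their isomorphisms. $\mathbf{IO}^{\mathrm{alg}}(A,\ast)/{\cong}$, $\mathbf{IO}^{\mathrm{alg}}(A,\ast)/{\sim}$, $\mathbf{IO}^{\mathrm{mod}}(A,\ast)/{\cong}$, $\mathbf{IO}^{\mathrm{mod}}(A,\ast)/{\sim}$ denote the sets of equivalence classes. Two dendriform trialgebras $(A,\prec_i,\succ_i,\cdot_i)$, $i=1,2$, on $A$ are isomorphic if there is a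 $\mathbf{k}$-linear bijection $F:A\to A$ with $F(x\prec_1y)=F(x)\prec_2F(y)$, $F(x\succ_1y)=F(x)\succ_2F(y)$, $F(x\cdot_1y)=F(x)\cdot_2F(y)$ for all $x,y\in A$; isomorphism of dendriform dialgebras on $A$ is defined likewise using only $\prec,\succ$. $\mathbf{DT}(A,\ast)/{\cong}$ and $\mathbf{DD}(A,\ast)/{\cong}$ denote the sets of isomorphism classes.
   Formalization: For the algebra half, bijectivity and surjectivity are proved only for invertible λ (the induced maps exist for every λ); for non-invertible λ the claim fails, e.g. for A = k with ≺ = ≻ = 0 and · the product of k. *)

(* Defs.v *)
From mathcomp Require Import all_boot all_order all_algebra.

Set Implicit Arguments.
Unset Strict Implicit.
Unset Printing Implicit Defensive.

Import GRing.Theory.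
Local Open Scope ring_scope.

(* The library's [bilinear_for] requires a nontrivial ground ring; the ground
   ring here is only assumed commutative and unitary. *)
Definition bilinear_map (k : pzRingType) (U V W : lmodType k)
    (m : U -> V -> W) : Prop :=
  (forall v, linear (m^~ v)) /\ (forall u, linear (m u)).

Definition is_algebra (k : pzRingType) (V : lmodType k) (m : V -> V -> V) : Prop :=
  bilinear_map m /\ associative m.

(* Not necessarily unitary, hence not one of the library's (unitary) algebras. *)
Record kalgebra (k : pzRingType) := KAlgebra {
  kalg_sort :> lmodType k;
  kmul : kalg_sort -> kalg_sort -> kalg_sort;
  kalgP : is_algebra kmul
}.

Section Bimodules.
Variables (k : pzRingType) (A : kalgebra k).
Local Notation "x * y" := (kmul x y).

(* [l x v] is l(x)v and [r v x] is v r(x).  Bilinearity says that l and r are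
   linear maps from A to End(V). *)
Definition is_bimodule (V : lmodType k) (l : A -> V -> V) (r : V -> A -> V) : Prop :=
  [/\ bilinear_map l, bilinear_map r,
      forall x y v, l (x * y) v = l x (l y v),
      forall x y v, r v (x * y) = r (r v x) y &
      forall x y v, r (l x v) y = l x (r v y)].

Record bimodule := Bimodule {
  bimod_sort :> lmodType k;
  lact : A -> bimod_sort -> bimod_sort;
  ract : bimod_sort -> A -> bimod_sort;
  bimodP : is_bimodule lact ract
}.

Record bimodule_algebra := BimoduleAlgebra {
  bimod_of :> bimodule;
  circ : bimod_of -> bimod_of -> bimod_of;
  circP : is_algebra circ;
  lact_circ : forall x v w, lact x (circ v w) = circ (lact x v) w;
  circ_ract : forall x v w, ract (circ v w) x = circ v (ract w x);
  circ_middle : forall x v w, circ (ract v x) w = circ v (lact x w)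
}.

(* The actions are explicit arguments, so that the same predicate applies to
   actions twisted by an automorphism of A. *)
Definition is_bimod_iso (V1 V2 : lmodType k)
    (l1 : A -> V1 -> V1) (r1 : V1 -> A -> V1)
    (l2 : A -> V2 -> V2) (r2 : V2 -> A -> V2) (g : {linear V1 -> V2}) : Prop :=
  [/\ bijective g,
      forall x v, g (l1 x v) = l2 x (g v) &
      forall x v, g (r1 v x) = r2 (g v) x].

Definition is_mult (V1 V2 : Type) (c1 : V1 -> V1 -> V1) (c2 : V2 -> V2 -> V2)
    (g : V1 -> V2) : Prop :=
  forall v w, g (c1 v w) = c2 (g v) (g w).

(* Invertibility is recorded by the two-sided inverse, which the map determines. *)
Record inv_Oop_mod := InvOopMod {
  Omod_dom : bimodule;
  Omod_map : {linear Omod_dom -> A};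
  Omod_inv : A -> Omod_dom;
  Omod_mapK : cancel Omod_map Omod_inv;
  Omod_invK : cancel Omod_inv Omod_map;
  OmodP : forall u v, Omod_map u * Omod_map v =
    Omod_map (lact (Omod_map u) v) + Omod_map (ract u (Omod_map v))
}.

Record inv_Oop_alg (lam : k) := InvOopAlg {
  Oalg_dom : bimodule_algebra;
  Oalg_map : {linear Oalg_dom -> A};
  Oalg_inv : A -> Oalg_dom;
  Oalg_mapK : cancel Oalg_map Oalg_inv;
  Oalg_invK : cancel Oalg_inv Oalg_map;
  OalgP : forall u v, Oalg_map u * Oalg_map v =
    Oalg_map (lact (Oalg_map u) v) + Oalg_map (ract u (Oalg_map v))
    + lam *: Oalg_map (circ u v)
}.

Definition Oalg_isom (lam : k) (a1 a2 : inv_Oop_alg lam) : Prop :=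
  exists g : {linear Oalg_dom a1 -> Oalg_dom a2},
    [/\ is_bimod_iso (@lact (Oalg_dom a1)) (@ract (Oalg_dom a1))
                     (@lact (Oalg_dom a2)) (@ract (Oalg_dom a2)) g,
        is_mult (@circ (Oalg_dom a1)) (@circ (Oalg_dom a2)) g &
        forall u, Oalg_map a1 u = Oalg_map a2 (g u)].

Definition Oalg_equiv (lam : k) (a1 a2 : inv_Oop_alg lam) : Prop :=
  exists (f : {linear A -> A}) (finv : A -> A)
         (g : {linear Oalg_dom a1 -> Oalg_dom a2}),
    [/\ cancel f finv, cancel finv f & is_mult (@kmul k A) (@kmul k A) f] /\
    [/\ is_bimod_iso (fun x => @lact (Oalg_dom a1) (finv x))
                     (fun v x => @ract (Oalg_dom a1) v (finv x))
                     (@lact (Oalg_dom a2)) (@ract (Oalg_dom a2)) g,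
        is_mult (@circ (Oalg_dom a1)) (@circ (Oalg_dom a2)) g &
        forall u, f (Oalg_map a1 u) = Oalg_map a2 (g u)].

Definition Omod_isom (a1 a2 : inv_Oop_mod) : Prop :=
  exists g : {linear Omod_dom a1 -> Omod_dom a2},
    is_bimod_iso (@lact (Omod_dom a1)) (@ract (Omod_dom a1))
                 (@lact (Omod_dom a2)) (@ract (Omod_dom a2)) g /\
    (forall u, Omod_map a1 u = Omod_map a2 (g u)).

Definition Omod_equiv (a1 a2 : inv_Oop_mod) : Prop :=
  exists (f : {linear A -> A}) (finv : A -> A)
         (g : {linear Omod_dom a1 -> Omod_dom a2}),
    [/\ cancel f finv, cancel finv f & is_mult (@kmul k A) (@kmul k A) f] /\
    is_bimod_iso (fun x => @lact (Omod_dom a1) (finv x))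
                 (fun v x => @ract (Omod_dom a1) v (finv x))
                 (@lact (Omod_dom a2)) (@ract (Omod_dom a2)) g /\
    (forall u, f (Omod_map a1 u) = Omod_map a2 (g u)).

End Bimodules.

Definition is_dend_dialgebra (k : pzRingType) (D : lmodType k)
    (prec succ : D -> D -> D) : Prop :=
  let star x y := prec x y + succ x y in
  [/\ bilinear_map prec, bilinear_map succ &
  [/\ forall x y z, prec (prec x y) z = prec x (star y z),
      forall x y z, prec (succ x y) z = succ x (prec y z) &
      forall x y z, succ x (succ y z) = succ (star x y) z]].

Definition is_dend_trialgebra (k : pzRingType) (T : lmodType k)
    (prec succ dot : T -> T -> T) : Prop :=
  let star x y := prec x y + succ x y + dot x y in
  [/\ bilinear_map prec, bilinear_map succ & bilinear_map dot] /\
  [/\ forall x y z, prec (prec x y) z = prec x (star y z),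
      forall x y z, prec (succ x y) z = succ x (prec y z) &
      forall x y z, succ (star x y) z = succ x (succ y z)] /\
  [/\ forall x y z, dot (succ x y) z = succ x (dot y z),
      forall x y z, dot (prec x y) z = dot x (succ y z),
      forall x y z, prec (dot x y) z = dot x (prec y z) &
      forall x y z, dot (dot x y) z = dot x (dot y z)].

Section Dendriform.
Variables (k : comPzRingType) (A : kalgebra k).

Record DD := MkDD {
  DD_prec : A -> A -> A;
  DD_succ : A -> A -> A;
  DD_axioms : is_dend_dialgebra DD_prec DD_succ;
  DD_split : forall x y, kmul x y = DD_prec x y + DD_succ x y
}.

Record DT := MkDT {
  DT_prec : A -> A -> A;
  DT_succ : A -> A -> A;
  DT_dot : A -> A -> A;
  DT_axioms : is_dend_trialgebra DT_prec DT_succ DT_dot;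
  DT_split : forall x y, kmul x y = DT_prec x y + DT_succ x y + DT_dot x y
}.

Definition DD_isom (S1 S2 : DD) : Prop :=
  exists F : {linear A -> A},
    [/\ bijective F, is_mult (DD_prec S1) (DD_prec S2) F &
        is_mult (DD_succ S1) (DD_succ S2) F].

Definition DT_isom (S1 S2 : DT) : Prop :=
  exists F : {linear A -> A},
    [/\ bijective F, is_mult (DT_prec S1) (DT_prec S2) F,
        is_mult (DT_succ S1) (DT_succ S2) F &
        is_mult (DT_dot S1) (DT_dot S2) F].

Section Mod.
Variable a : inv_Oop_mod A.

Definition Omod_prec (x y : A) : A := Omod_map a (ract (Omod_inv a x) y).
Definition Omod_succ (x y : A) : A := Omod_map a (lact x (Omod_inv a y)).

Lemma Omod_split x y : kmul x y = Omod_prec x y + Omod_succ x y.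
Proof.
by rewrite -{1}(Omod_invK a x) -{1}(Omod_invK a y) OmodP !Omod_invK addrC.
Qed.

Lemma Omod_dend : is_dend_dialgebra Omod_prec Omod_succ.
Proof.
have invL : linear (Omod_inv a) by apply: (can2_linear (@Omod_mapK _ _ a) (@Omod_invK _ _ a)).
have [[ll1 ll2] [rl1 rl2] lM rM lr] := bimodP (Omod_dom a).
split; [split| split|split]; rewrite /Omod_prec /Omod_succ.
- by move=> y c u v /=; rewrite invL rl1 linearP.
- by move=> x c u v /=; rewrite rl2 linearP.
- by move=> y c u v /=; rewrite ll1 linearP.
- by move=> x c u v /=; rewrite invL ll2 linearP.
- move=> x y z; rewrite Omod_mapK -rM; congr (Omod_map _ (ract _ _)).
  exact: Omod_split.
- by move=> x y z; rewrite !Omod_mapK lr.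
- move=> x y z; rewrite Omod_mapK -lM; congr (Omod_map _ (lact _ _)).
  exact: Omod_split.
Qed.

Definition Psi_mod : DD := MkDD Omod_dend Omod_split.

End Mod.

Section Alg.
Variables (lam : k) (a : inv_Oop_alg A lam).

Definition Oalg_prec (x y : A) : A := Oalg_map a (ract (Oalg_inv a x) y).
Definition Oalg_succ (x y : A) : A := Oalg_map a (lact x (Oalg_inv a y)).
Definition Oalg_dot (x y : A) : A :=
  Oalg_map a (lam *: circ (Oalg_inv a x) (Oalg_inv a y)).

Lemma Oalg_split x y :
  kmul x y = Oalg_prec x y + Oalg_succ x y + Oalg_dot x y.
Proof.
rewrite -{1}(Oalg_invK a x) -{1}(Oalg_invK a y) OalgP !Oalg_invK.
by rewrite /Oalg_dot linearZ [X in X + _]addrC.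
Qed.

Lemma Oalg_dend : is_dend_trialgebra Oalg_prec Oalg_succ Oalg_dot.
Proof.
have invL : linear (Oalg_inv a) by apply: (can2_linear (@Oalg_mapK _ _ _ a) (@Oalg_invK _ _ _ a)).
have [[ll1 ll2] [rl1 rl2] lM rM lr] := bimodP (Oalg_dom a).
have [[cl1 cl2] cA] := circP (Oalg_dom a).
have lZ x c u : lact x (c *: u) = c *: lact (b := Oalg_dom a) x u.
  have l0 : lact (b := Oalg_dom a) x 0 = 0.
    by move: (ll2 x (-1) 0 0); rewrite scaleN1r addNr => ->; rewrite scaleN1r addNr.
  by move: (ll2 x c u 0); rewrite !addr0 l0 addr0.
have rZ x c u : ract (c *: u) x = c *: ract (b := Oalg_dom a) u x.
  have r0 : ract (b := Oalg_dom a) 0 x = 0.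
    by move: (rl1 x (-1) 0 0) => /=; rewrite scaleN1r addNr => ->; rewrite scaleN1r addNr.
  by move: (rl1 x c u 0) => /=; rewrite !addr0 r0 addr0.
have cZl w c u : circ (c *: u) w = c *: circ (b := Oalg_dom a) u w.
  have c0 : circ (b := Oalg_dom a) 0 w = 0.
    by move: (cl1 w (-1) 0 0) => /=; rewrite scaleN1r addNr => ->; rewrite scaleN1r addNr.
  by move: (cl1 w c u 0) => /=; rewrite !addr0 c0 addr0.
have cZr w c u : circ w (c *: u) = c *: circ (b := Oalg_dom a) w u.
  have c0 : circ (b := Oalg_dom a) w 0 = 0.
    by move: (cl2 w (-1) 0 0); rewrite scaleN1r addNr => ->; rewrite scaleN1r addNr.
  by move: (cl2 w c u 0); rewrite !addr0 c0 addr0.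
split; [split; split|split; split]; rewrite /Oalg_prec /Oalg_succ /Oalg_dot.
- by move=> y c u v /=; rewrite invL rl1 linearP.
- by move=> x c u v /=; rewrite rl2 linearP.
- by move=> y c u v /=; rewrite ll1 linearP.
- by move=> x c u v /=; rewrite invL ll2 linearP.
- move=> y c u v /=; rewrite invL cl1 scalerDr scalerA mulrC -scalerA.
  by rewrite linearP.
- move=> y c u v /=; rewrite invL cl2 scalerDr scalerA mulrC -scalerA.
  by rewrite linearP.
- move=> x y z; rewrite Oalg_mapK -rM; congr (Oalg_map _ (ract _ _)).
  exact: Oalg_split.
- by move=> x y z; rewrite !Oalg_mapK lr.
- move=> x y z; rewrite Oalg_mapK -lM; congr (Oalg_map _ (lact _ _)).
  exact/esym/Oalg_split.
- by move=> x y z; rewrite !Oalg_mapK lZ lact_circ.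
- by move=> x y z; rewrite !Oalg_mapK circ_middle.
- by move=> x y z; rewrite !Oalg_mapK rZ circ_ract.
- by move=> x y z; rewrite !Oalg_mapK cZl cZr cA.
Qed.

Definition Psi_alg : DT := MkDT Oalg_dend Oalg_split.

End Alg.
End Dendriform.

Section Quotients.
Variables (X : Type) (E : X -> X -> Prop).

(* The set of equivalence classes [E x]; E is meant to be an equivalence
   relation.  The index type may be large (it ranges over all bimodules), so the
   boolean quotients of the library do not apply. *)
Definition quotient : Type := {C : X -> Prop | exists x, C = E x}.

Definition eqclass (x : X) : quotient :=
  exist (fun C => exists y, C = E y) (E x) (ex_intro _ x erefl).

(* f factors through the projection, necessarily in a unique way. *)
Definition induces_map (Y : Type) (f : X -> Y) : Prop :=
  exists F : quotient -> Y, forall x, F (eqclass x) = f x.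

Definition induces_bijection (Y : Type) (f : X -> Y) : Prop :=
  exists2 F : quotient -> Y, (forall x, F (eqclass x) = f x) & bijective F.

End Quotients.

Definition surjective (X Y : Type) (f : X -> Y) : Prop :=
  forall y, exists x, f x = y.

(* Main.v *)
Require Import Defs.
From mathcomp Require Import all_boot all_order all_algebra.
From mathcomp Require Import boolp.
From HB Require Import structures.

(** Write [beta] for the inverse of an invertible O-operator [alpha : R -> A].
    The operations of [Psi alpha] are nothing but the actions of [A] on [R], and
    [lam] times the product of [R], carried over to [A] along [alpha]:
    for instance [x succ y = alpha (l x (beta y))].  Hence if [g : R1 -> R2] and
    [f : A -> A] are bijections with [f alpha1 = alpha2 g], so that either one
    determines the other, then [g] intertwines the twisted left actions exactly
    when [f] respects [succ], the right actions exactly when [f] respects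
    [prec], and [lam] times the products exactly when [f] respects [dot]
    ([lact_transport], [ract_transport], [circ_transport]).
    Such an [f] is multiplicative for the product of [A], because this product
    is the sum of the dendriform operations.  So equivalence of O-operators is
    isomorphism of their dendriform images, and the case [f = id] says that
    isomorphism of O-operators is equality of these images ([Omod_equivP],
    [Omod_isomP] and their algebra analogues).  The weight must be cancelled only
    to recover the product of [R] from [dot], that is, to come back from
    dendriform trialgebras to O-operators.

    For surjectivity, a dendriform structure on [A] splitting the product makes
    [A] a bimodule over itself through [succ] and [prec], for which the identity
    is an O-operator; in the trialgebra case the product to put on [A] is
    [lam^-1 dot].  The three axioms without [dot] are the bimodule axioms, and
    those with [dot] are the associativity of the product and its
    compatibility with the actions. *)

Set Implicit Arguments.
Unset Strict Implicit.
Unset Printing Implicit Defensive.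

Import GRing.Theory.
Local Open Scope ring_scope.

(** * Maps induced on quotients *)

Section QuotientTheory.
Variables (X : Type) (E : X -> X -> Prop).

Lemma eqclass_onto (C : quotient E) : exists x, C = eqclass E x.
Proof.
case: C => C p; have [x Cx] := p; exists x.
by subst C; congr exist; apply: Prop_irrelevance.
Qed.

Lemma eqclass_eqP (Er : forall x, E x x) (Es : forall x y, E x y -> E y x)
    (Et : forall x y z, E x y -> E y z -> E x z) x y :
  eqclass E x = eqclass E y <-> E x y.
Proof.
split=> [/(congr1 sval) /= -> //|Exy].
have EE : E x = E y.
  by apply/funext => z; apply/propext; split; apply: Et => //; apply: Es.
by apply: eq_exist.
Qed.

(** The value at a class is the value at a chosen representative; reflexivity of
    [E] ensures that [x] and the representative chosen for its class are
    related. *)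
Lemma induces_map_compat (Y : Type) (f : X -> Y) :
  (forall x, E x x) -> (forall x y, E x y -> f x = f y) -> induces_map E f.
Proof.
move=> Er fE; exists (fun C => f (sval (cid (eqclass_onto C)))) => x.
case: cid => y /= /(congr1 sval) /= Exy.
by apply: fE; rewrite -Exy.
Qed.

Lemma induces_bijection_compat (Y : Type) (f : X -> Y) :
  (forall x y, E x y <-> f x = f y) -> surjective f -> induces_bijection E f.
Proof.
move=> fE f_onto.
have Er x : E x x by apply/fE.
have [F FE] := induces_map_compat Er (fun x y => (fE x y).1).
exists F => //; exists (fun y => eqclass E (sval (cid (f_onto y)))) => [C|y].
  have [x ->] := eqclass_onto C; rewrite FE; case: cid => x' /= fx'.
  apply/eqclass_eqP => [//|u v /fE fuv|u v w /fE fuv /fE fvw|]; apply/fE => //.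
  by rewrite fuv.
by rewrite FE; case: cid.
Qed.

End QuotientTheory.

(** * Isomorphism of dendriform structures *)

Lemma is_mult_comp (U V W : Type) cU cV cW (f : U -> V) (g : V -> W) :
  is_mult cU cV f -> is_mult cV cW g -> is_mult cU cW (g \o f).
Proof. by move=> fM gM x y; rewrite /= fM gM. Qed.

Lemma is_mult_inv (U V : Type) cU cV (f : U -> V) (g : V -> U) :
  cancel f g -> cancel g f -> is_mult cU cV f -> is_mult cV cU g.
Proof. by move=> fK gK fM x y; apply: (can_inj fK); rewrite fM !gK. Qed.

Lemma linear_inverse (k : pzRingType) (U V : lmodType k) (f : {linear U -> V})
    (g : V -> U) :
  cancel f g -> cancel g f -> exists h : {linear V -> U}, h =1 g.
Proof.
move=> fK gK; have g_lin : linear g := can2_linear fK gK.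
pose h : {linear V -> U} := HB.pack g (GRing.isLinear.Build _ _ _ _ g g_lin).
by exists h.
Qed.

Section DendriformIso.
Variables (k : comPzRingType) (A : kalgebra k).

(** Proofs being irrelevant, a dendriform structure is its operations. *)
Lemma DD_ext (S1 S2 : DD A) :
  is_mult (DD_prec S1) (DD_prec S2) id -> is_mult (DD_succ S1) (DD_succ S2) id ->
  S1 = S2.
Proof.
case: S1 S2 => p1 s1 ax1 sp1 [p2 s2 ax2 sp2] /= ep es.
have {}ep : p1 = p2 by apply/funext => x; apply/funext => y; apply: ep.
have {}es : s1 = s2 by apply/funext => x; apply/funext => y; apply: es.
by subst; congr MkDD; apply: Prop_irrelevance.
Qed.

Lemma DT_ext (S1 S2 : DT A) :
  is_mult (DT_prec S1) (DT_prec S2) id -> is_mult (DT_succ S1) (DT_succ S2) id ->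
  is_mult (DT_dot S1) (DT_dot S2) id -> S1 = S2.
Proof.
case: S1 S2 => p1 s1 d1 ax1 sp1 [p2 s2 d2 ax2 sp2] /= ep es ed.
have {}ep : p1 = p2 by apply/funext => x; apply/funext => y; apply: ep.
have {}es : s1 = s2 by apply/funext => x; apply/funext => y; apply: es.
have {}ed : d1 = d2 by apply/funext => x; apply/funext => y; apply: ed.
by subst; congr MkDT; apply: Prop_irrelevance.
Qed.

Lemma DD_isom_class (S1 S2 : DD A) :
  eqclass (@DD_isom k A) S1 = eqclass (@DD_isom k A) S2 <-> DD_isom S1 S2.
Proof.
apply: eqclass_eqP => [S|S T|S T U].
- by exists idfun; split=> //; exists id.
- case=> F [[G FK GK] Fp Fs].
  have [H /funext HG] := linear_inverse FK GK; exists H; rewrite HG.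
  by split; [exists F | apply: is_mult_inv Fp | apply: is_mult_inv Fs].
- case=> F [Fb Fp Fs] [G [Gb Gp Gs]]; exists (G \o F).
  by split; [apply: bij_comp | apply: is_mult_comp Gp | apply: is_mult_comp Gs].
Qed.

Lemma DT_isom_class (S1 S2 : DT A) :
  eqclass (@DT_isom k A) S1 = eqclass (@DT_isom k A) S2 <-> DT_isom S1 S2.
Proof.
apply: eqclass_eqP => [S|S T|S T U].
- by exists idfun; split=> //; exists id.
- case=> F [[G FK GK] Fp Fs Fd].
  have [H /funext HG] := linear_inverse FK GK; exists H; rewrite HG.
  split; [by exists F|exact: is_mult_inv Fp|exact: is_mult_inv Fs|].
  exact: is_mult_inv Fd.
- case=> F [Fb Fp Fs Fd] [G [Gb Gp Gs Gd]]; exists (G \o F).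
  split; [exact: bij_comp|exact: is_mult_comp Gp|exact: is_mult_comp Gs|].
  exact: is_mult_comp Gd.
Qed.

(** The product of [A] is the sum of the dendriform operations. *)
Lemma DD_isom_mult (S1 S2 : DD A) (F : {linear A -> A}) :
  is_mult (DD_prec S1) (DD_prec S2) F -> is_mult (DD_succ S1) (DD_succ S2) F ->
  is_mult (@kmul k A) (@kmul k A) F.
Proof. by move=> Fp Fs x y; rewrite (DD_split S1) (DD_split S2) linearD Fp Fs. Qed.

Lemma DT_isom_mult (S1 S2 : DT A) (F : {linear A -> A}) :
  is_mult (DT_prec S1) (DT_prec S2) F -> is_mult (DT_succ S1) (DT_succ S2) F ->
  is_mult (DT_dot S1) (DT_dot S2) F -> is_mult (@kmul k A) (@kmul k A) F.
Proof.
by move=> Fp Fs Fd x y; rewrite (DT_split S1) (DT_split S2) !linearD Fp Fs Fd.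
Qed.

End DendriformIso.

(** * Transport of operations along invertible maps *)

(** The two vertical maps of a commutative square whose horizontal maps
    [alpha1] and [alpha2] are bijective determine each other. *)
Lemma linear_conjugate (k : pzRingType) (A V1 V2 : lmodType k)
    (alpha1 : {linear V1 -> A}) (beta1 : A -> V1)
    (alpha2 : {linear V2 -> A}) (beta2 : A -> V2) (f : {linear A -> A}) :
  cancel alpha1 beta1 -> cancel beta1 alpha1 ->
  cancel alpha2 beta2 -> cancel beta2 alpha2 -> bijective f ->
  exists2 g : {linear V1 -> V2}, bijective g & forall u, f (alpha1 u) = alpha2 (g u).
Proof.
move=> aK1 bK1 aK2 bK2 fb; have [h /funext hE] := linear_inverse aK2 bK2.
exists (h \o (f \o alpha1)) => [|u]; last by rewrite /= hE bK2.
apply: bij_comp; first by rewrite hE; exists alpha2.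
by apply: bij_comp => //; exists beta1.
Qed.

Section Transport.
Variables (A V1 V2 : Type).
Variables (alpha1 : V1 -> A) (beta1 : A -> V1).
Variables (alpha2 : V2 -> A) (beta2 : A -> V2).
Hypotheses (alpha1K : cancel alpha1 beta1) (beta1K : cancel beta1 alpha1).
Hypotheses (alpha2K : cancel alpha2 beta2) (beta2K : cancel beta2 alpha2).
Variables (f finv : A -> A) (g : V1 -> V2).
Hypotheses (fK : cancel f finv) (finvK : cancel finv f).
Hypothesis fg : forall u, f (alpha1 u) = alpha2 (g u).

Let betaf x : beta2 (f x) = g (beta1 x).
Proof. by rewrite -{1}(beta1K x) fg alpha2K. Qed.

Let g_def v : g v = beta2 (f (alpha1 v)).
Proof. by rewrite fg alpha2K. Qed.

(** Writing [x] as [f (finv x)] absorbs the twist of the first actions by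
    [finv], so that both sides say the same up to [alpha1] and [alpha2]. *)
Lemma lact_transport (l1 : A -> V1 -> V1) (l2 : A -> V2 -> V2) :
  (forall x v, g (l1 (finv x) v) = l2 x (g v)) <->
  is_mult (fun x y => alpha1 (l1 x (beta1 y)))
          (fun x y => alpha2 (l2 x (beta2 y))) f.
Proof.
split=> [gl x y|fl x v]; first by rewrite fg betaf -gl fK.
have := fl (finv x) (alpha1 v).
by rewrite alpha1K finvK -g_def fg => /(can_inj alpha2K).
Qed.

Lemma ract_transport (r1 : V1 -> A -> V1) (r2 : V2 -> A -> V2) :
  (forall x v, g (r1 v (finv x)) = r2 (g v) x) <->
  is_mult (fun x y => alpha1 (r1 (beta1 x) y))
          (fun x y => alpha2 (r2 (beta2 x) y)) f.
Proof.
split=> [gr x y|fr x v]; first by rewrite fg betaf -gr fK.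
have := fr (alpha1 v) (finv x).
by rewrite alpha1K finvK -g_def fg => /(can_inj alpha2K).
Qed.

Lemma circ_transport (c1 : V1 -> V1 -> V1) (c2 : V2 -> V2 -> V2) :
  is_mult c1 c2 g <->
  is_mult (fun x y => alpha1 (c1 (beta1 x) (beta1 y)))
          (fun x y => alpha2 (c2 (beta2 x) (beta2 y))) f.
Proof.
split=> [gc x y|fc u v]; first by rewrite fg !betaf -gc.
have := fc (alpha1 u) (alpha1 v).
by rewrite !alpha1K -!g_def fg => /(can_inj alpha2K).
Qed.

End Transport.

(** * Invertible operators on modules *)

Section ModOperators.
Variables (k : comPzRingType) (A : kalgebra k).
Implicit Types a b : inv_Oop_mod A.

Lemma Omod_equivP a b : Omod_equiv a b <-> DD_isom (Psi_mod a) (Psi_mod b).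
Proof.
have [aK aiK bK biK] :=
  And4 (@Omod_mapK _ _ a) (@Omod_invK _ _ a) (@Omod_mapK _ _ b) (@Omod_invK _ _ b).
split=> [[f [finv [g [[fK finvK _] [[_ gl gr] fg]]]]]|[f [fb fp fs]]].
  exists f; split; first by exists finv.
    by apply/(ract_transport aK aiK bK fK finvK fg).
  by apply/(lact_transport aK aiK bK fK finvK fg).
have [g gb fg] := linear_conjugate aK aiK bK biK fb.
have [finv fK finvK] := fb.
exists f, finv, g; split; first by split=> //; apply: DD_isom_mult fp fs.
split=> //; split=> //.
  by apply/(lact_transport aK aiK bK fK finvK fg).
by apply/(ract_transport aK aiK bK fK finvK fg).
Qed.

Lemma Omod_isomP a b : Omod_isom a b <-> Psi_mod a = Psi_mod b.
Proof.
have [aK aiK bK biK] :=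
  And4 (@Omod_mapK _ _ a) (@Omod_invK _ _ a) (@Omod_mapK _ _ b) (@Omod_invK _ _ b).
have idK : @cancel A A id id by [].
split=> [[g [[_ gl gr] fg]]|eqab].
  apply: DD_ext.
    by apply/(ract_transport aK aiK bK idK idK fg).
  by apply/(lact_transport aK aiK bK idK idK fg).
have [fp fs] : is_mult (Omod_prec a) (Omod_prec b) id /\
               is_mult (Omod_succ a) (Omod_succ b) id.
  by split=> x y; [have /= -> := congr1 (@DD_prec _ _) eqab
                  |have /= -> := congr1 (@DD_succ _ _) eqab].
have [g gb fg] := linear_conjugate (f := idfun) aK aiK bK biK (Bijective idK idK).
exists g; split=> //; split=> //.
  by apply/(lact_transport aK aiK bK idK idK fg).
by apply/(ract_transport aK aiK bK idK idK fg).
Qed.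

Lemma DD_is_bimodule (S : DD A) : is_bimodule (DD_succ S) (DD_prec S).
Proof.
have [bp bs [pp sp ss]] := DD_axioms S.
by split=> // x y v; rewrite (DD_split S) ?pp ?ss.
Qed.

Definition DD_bimodule (S : DD A) : bimodule A := Bimodule (DD_is_bimodule S).

Definition DD_Oop (S : DD A) : inv_Oop_mod A.
Proof.
refine (@InvOopMod _ _ (DD_bimodule S) idfun id _ _ _) => // u v.
by rewrite (DD_split S) addrC.
Defined.

Lemma Psi_mod_surj : surjective (@Psi_mod k A).
Proof. by move=> S; exists (DD_Oop S); apply: DD_ext. Qed.

End ModOperators.

(** * Invertible operators on algebras *)

Section BilinearScale.
Variables (k : comPzRingType) (U V W : lmodType k) (m : U -> V -> W) (c : k).
Hypothesis m_bilin : bilinear_map m.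

Lemma bilinear_scale : bilinear_map (fun u v => c *: m u v).
Proof.
have [ml mr] := m_bilin.
by split=> [v|u] d x y /=; rewrite ?ml ?mr scalerDr !scalerA mulrC.
Qed.

Lemma bilinear_scalel u v : m (c *: u) v = c *: m u v.
Proof.
have [ml _] := m_bilin.
have m0 : m 0 v = 0 by have := ml v (-1) 0 0; rewrite /= !scaleN1r !addNr.
by have := ml v c u 0; rewrite /= m0 !addr0.
Qed.

Lemma bilinear_scaler u v : m u (c *: v) = c *: m u v.
Proof.
have [_ mr] := m_bilin.
have m0 : m u 0 = 0 by have := mr u (-1) 0 0; rewrite /= !scaleN1r !addNr.
by have := mr u c v 0; rewrite /= m0 !addr0.
Qed.

End BilinearScale.

Section AlgOperators.
Variables (k : comPzRingType) (A : kalgebra k) (lam : k).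
Implicit Types a b : inv_Oop_alg A lam.

Lemma Oalg_isom_refl a : Oalg_isom a a.
Proof. by exists idfun; split=> //; split=> //; exists id. Qed.

Lemma Oalg_equiv_refl a : Oalg_equiv a a.
Proof. by exists idfun, id, idfun; split=> //; split=> //; split=> //; exists id. Qed.

Lemma is_mult_scale (V1 V2 : lmodType k) c1 c2 (g : {linear V1 -> V2}) :
  is_mult c1 c2 g ->
  is_mult (fun u v => lam *: c1 u v) (fun u v => lam *: c2 u v) g.
Proof. by move=> gM u v; rewrite linearZ gM. Qed.

Lemma dot_transport a b (f : A -> A) (g : Oalg_dom a -> Oalg_dom b) :
  (forall u, f (Oalg_map a u) = Oalg_map b (g u)) ->
  is_mult (fun u v => lam *: circ u v) (fun u v => lam *: circ u v) g <->
  is_mult (Oalg_dot a) (Oalg_dot b) f.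
Proof.
move=> fg; pose lamcirc (V : bimodule_algebra A) (u v : V) := lam *: circ u v.
by refine (circ_transport (@Oalg_mapK _ _ _ a) (@Oalg_invK _ _ _ a)
             (@Oalg_mapK _ _ _ b) fg (@lamcirc _) (@lamcirc _)).
Qed.

Lemma Oalg_equiv_DT a b : Oalg_equiv a b -> DT_isom (Psi_alg a) (Psi_alg b).
Proof.
have [aK aiK bK] := And3 (@Oalg_mapK _ _ _ a) (@Oalg_invK _ _ _ a) (@Oalg_mapK _ _ _ b).
case=> f [finv [g [[fK finvK _] [[_ gl gr] gc fg]]]].
exists f; split; first by exists finv.
- by apply/(ract_transport aK aiK bK fK finvK fg).
- by apply/(lact_transport aK aiK bK fK finvK fg).
- exact/(dot_transport fg)/is_mult_scale.
Qed.

Lemma Oalg_isom_DT a b : Oalg_isom a b -> Psi_alg a = Psi_alg b.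
Proof.
have [aK aiK bK] := And3 (@Oalg_mapK _ _ _ a) (@Oalg_invK _ _ _ a) (@Oalg_mapK _ _ _ b).
have idK : @cancel A A id id by [].
case=> g [[_ gl gr] gc fg]; apply: DT_ext.
- by apply/(ract_transport aK aiK bK idK idK fg).
- by apply/(lact_transport aK aiK bK idK idK fg).
- exact/(dot_transport (f := id) fg)/is_mult_scale.
Qed.

Section UnitWeight.
Variables (mu : k) (mulam : mu * lam = 1).

Lemma is_mult_unscale (V1 V2 : lmodType k) c1 c2 (g : {linear V1 -> V2}) :
  is_mult (fun u v => lam *: c1 u v) (fun u v => lam *: c2 u v) g ->
  is_mult c1 c2 g.
Proof.
move=> gM u v; have /(congr1 (fun w => mu *: w)) := gM u v.
by rewrite linearZ !scalerA mulam !scale1r.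
Qed.

Lemma Oalg_equivP a b : Oalg_equiv a b <-> DT_isom (Psi_alg a) (Psi_alg b).
Proof.
split=> [|[f [fb fp fs fd]]]; first exact: Oalg_equiv_DT.
have [aK aiK bK biK] := And4 (@Oalg_mapK _ _ _ a) (@Oalg_invK _ _ _ a)
                             (@Oalg_mapK _ _ _ b) (@Oalg_invK _ _ _ b).
have [g gb fg] := linear_conjugate aK aiK bK biK fb.
have [finv fK finvK] := fb.
exists f, finv, g; split; first by split=> //; apply: DT_isom_mult fp fs fd.
split=> //; last exact/is_mult_unscale/(dot_transport fg).
split=> //.
  by apply/(lact_transport aK aiK bK fK finvK fg).
by apply/(ract_transport aK aiK bK fK finvK fg).
Qed.

Lemma Oalg_isomP a b : Oalg_isom a b <-> Psi_alg a = Psi_alg b.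
Proof.
split=> [|eqab]; first exact: Oalg_isom_DT.
have [aK aiK bK biK] := And4 (@Oalg_mapK _ _ _ a) (@Oalg_invK _ _ _ a)
                             (@Oalg_mapK _ _ _ b) (@Oalg_invK _ _ _ b).
have idK : @cancel A A id id by [].
have [fp fs fd] : [/\ is_mult (Oalg_prec a) (Oalg_prec b) id,
    is_mult (Oalg_succ a) (Oalg_succ b) id & is_mult (Oalg_dot a) (Oalg_dot b) id].
  by split=> x y; [have /= -> := congr1 (@DT_prec _ _) eqab
                  |have /= -> := congr1 (@DT_succ _ _) eqab
                  |have /= -> := congr1 (@DT_dot _ _) eqab].
have [g gb fg] := linear_conjugate (f := idfun) aK aiK bK biK (Bijective idK idK).
exists g; split=> //; last first.
  exact/is_mult_unscale/(dot_transport (f := id) fg).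
split=> //.
  by apply/(lact_transport aK aiK bK idK idK fg).
by apply/(ract_transport aK aiK bK idK idK fg).
Qed.

Lemma DT_is_bimodule (S : DT A) : is_bimodule (DT_succ S) (DT_prec S).
Proof.
have [[bp bs _] [[pp sp ss] _]] := DT_axioms S.
by split=> // x y v; rewrite (DT_split S) ?pp ?ss.
Qed.

Definition DT_bimodule (S : DT A) : bimodule A := Bimodule (DT_is_bimodule S).

(** The factor [mu] in the product makes up for the weight in the definition of
    the trialgebra product of an O-operator. *)
Definition DT_bimodule_algebra (S : DT A) : bimodule_algebra A.
Proof.
refine (@BimoduleAlgebra _ _ (DT_bimodule S) (fun u v => mu *: DT_dot S u v)
  _ _ _ _) => [|x v w|x v w|x v w] /=;
  have [[bp bs bd] [_ [sd pd dp dd]]] := DT_axioms S.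
- split; first exact: bilinear_scale.
  by move=> x y z; rewrite (bilinear_scalel _ bd) (bilinear_scaler _ bd) dd.
- by rewrite (bilinear_scaler _ bs) sd.
- by rewrite (bilinear_scalel _ bp) dp.
- by rewrite pd.
Defined.

Definition DT_Oop (S : DT A) : inv_Oop_alg A lam.
Proof.
refine (@InvOopAlg _ _ _ (DT_bimodule_algebra S) idfun id _ _ _) => // u v /=.
rewrite scalerA [lam * mu]mulrC mulam scale1r (DT_split S).
by congr (_ + _); apply: addrC.
Defined.

Lemma Psi_alg_surj : surjective (@Psi_alg k A lam).
Proof.
move=> S; exists (DT_Oop S); apply: DT_ext => // x y /=.
by rewrite /Oalg_dot /= scalerA [lam * mu]mulrC mulam scale1r.
Qed.

End UnitWeight.
End AlgOperators.

(* The induced maps exist for every weight lam.  Bijectivity in the algebra case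
   needs lam to be a unit: for A = k, reaching the trialgebra whose dot is the
   product of k, with prec = succ = 0, forces lam to be invertible. *)
Theorem theorem3p5 (k : comPzRingType) (lam : k) (A : kalgebra k) :
  [/\ induces_map (@Oalg_isom k A lam) (@Psi_alg k A lam),
      induces_map (@Oalg_equiv k A lam)
        (fun a => eqclass (@DT_isom k A) (Psi_alg a)) &
      (exists mu : k, mu * lam = 1) ->
      [/\ induces_bijection (@Oalg_isom k A lam) (@Psi_alg k A lam),
          induces_bijection (@Oalg_equiv k A lam)
            (fun a => eqclass (@DT_isom k A) (Psi_alg a)) &
          surjective (@Psi_alg k A lam)]] /\
  [/\ induces_bijection (@Omod_isom k A) (@Psi_mod k A),
      induces_bijection (@Omod_equiv k A)
        (fun a => eqclass (@DD_isom k A) (Psi_mod a)) &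
      surjective (@Psi_mod k A)].
Proof.
split; last first.
  have Psi_onto := @Psi_mod_surj k A; split=> //.
    by apply: induces_bijection_compat => // a b; apply: Omod_isomP.
  apply: induces_bijection_compat => [a b|C].
    by rewrite DD_isom_class; apply: Omod_equivP.
  by have [S ->] := eqclass_onto C; have [a <-] := Psi_onto S; exists a.
split.
- by apply: induces_map_compat; [apply: Oalg_isom_refl | apply: Oalg_isom_DT].
- apply: induces_map_compat => [|a b ab]; first exact: Oalg_equiv_refl.
  by apply/DT_isom_class/Oalg_equiv_DT.
- case=> mu mulam; have Psi_onto := Psi_alg_surj (A := A) mulam; split=> //.
    by apply: induces_bijection_compat => // a b; apply: Oalg_isomP mulam _ _.
  apply: induces_bijection_compat => [a b|C].
    by rewrite DT_isom_class; apply: Oalg_equivP mulam _ _.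
  by have [S ->] := eqclass_onto C; have [a <-] := Psi_onto S; exists a.
Qed.
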